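(* Let $M$ be a connected finite-dimensional differentiable manifold of positive dimension, and let $f\colon M\to M$ be an Anosov-realizable $C^1$ diffeomorphism, that is, $f$ is Anosov with respect to some Riemannian metric on $M$. Then $f$ is topologically expansive.
   Context: No compactness of $M$ and no completeness of the Riemannian metric is assumed. **Anosov.** A $C^1$ diffeomorphism $f\colon M\to M$ is Anosov with respect to a Riemannian metric on $M$ (with induced norm $\|\cdot\|$) if there exist a continuous $Df$-invariant splitting $TM=E^s\oplus E^u$ and constants $C>0$, $\lambda\in(0,1)$ such that $$\|Df_x^n|_{E_x^s}\|\leq C\lambda^n,\qquad \|Df_x^{-n}|_{E_x^u}\|\leq C\lambda^n$$ for every $x\in M$ and every integer $n\geq 0$. The diffeomorphism $f$ is called Anosov-realizable (or Anosable) if it is Anosov with respect to some Riemannian metric of $M$. **Topologically expansive.** Let $(Y,\rho)$ be a metric space with the topology induced by $\rho$. A homeomorphism $g\colon Y\to Y$ is topologically expansive if there exists a continuous function $\varepsilon\colon Y\to(0,\infty)$ such that, for all $x,y\in Y$, $$\rho(g^n(x),g^n(y))<\varepsilon(g^n(x))\quad\text{for every }n\in\mathbb Z$$ implies $x=y$. This property is independent of the choice of metric $\rho$ inducing the given topology. The manifold $M$ is regarded as a metric space with a metric inducing its manifold topology (for instance the distance of any Riemannian metric on $M$). *)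

(* Defs.v *)
From HB Require Import structures.
From mathcomp Require Import all_boot all_order all_algebra.
From mathcomp Require Import all_classical all_reals all_analysis.
Set Implicit Arguments.
Unset Strict Implicit.
Unset Printing Implicit Defensive.
Import Order.TTheory GRing.Theory Num.Theory.
Import numFieldNormedType.Exports.
Local Open Scope classical_set_scope.
Local Open Scope ring_scope.

(** A regularity class C^r with r in {0, 1, 2, ..., oo}; [None] is r = oo. *)
Definition regularity := option nat.

Definition reg_le (k : nat) (r : regularity) : bool :=
  if r is Some m then (k <= m)%N else true.

(** [f] is C^k on [U]; meaningful for [U] open, since [differentiable] and
    [derive] are relative to full neighbourhoods. *)
Fixpoint is_Ck (R : realType) (V W : normedModType R) (k : nat) (U : set V)
    (f : V -> W) : Prop :=
  match k with
  | 0 => {in U, continuous f}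
  | k'.+1 => {in U, forall x, differentiable f x} /\
             (forall v : V, is_Ck k' U (fun x => 'D_v f x))
  end.

(** A C^r atlas modelled on R^n on the metric space [M], whose distance induces
    the manifold topology ([M] is thus Hausdorff; when connected it is also
    second countable). Charts and their inverses are total functions, whose
    values outside [dom c], resp. [chart c @` dom c], are irrelevant.
    [chart_at x] is a preferred chart around [x], used to give coordinates on
    the tangent space at [x]. *)
Record atlas (R : realType) (r : regularity) (n : nat) (M : metricType R) := {
  idx : Type ;
  dom : idx -> set M ;
  chart : idx -> M -> 'rV[R]_n ;
  chart_inv : idx -> 'rV[R]_n -> M ;
  chart_at : M -> idx ;
  dom_open : forall c, open (dom c) ;
  dom_chart_at : forall x, dom (chart_at x) x ;
  codom_open : forall c, open (chart c @` dom c) ;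
  chartK : forall c, {in dom c, cancel (chart c) (chart_inv c)} ;
  chart_continuous : forall c, {in dom c, continuous (chart c)} ;
  chart_inv_continuous :
    forall c, {in chart c @` dom c, continuous (chart_inv c)} ;
  transition_Cr : forall (c d : idx) (k : nat), reg_le k r ->
    is_Ck k (chart c @` (dom c `&` dom d)) (chart d \o chart_inv c) }.

Section Manifold.
Context {R : realType} {r : regularity} {n : nat} {M : metricType R}.
Variable A : atlas r n M.

Definition C1_map (f : M -> M) : Prop :=
  continuous f /\
  forall c d : idx A,
    is_Ck 1 (chart c @` (dom c `&` f @^-1` dom d))
      (chart d \o f \o chart_inv c).

(** [finv] is the inverse of [f]. *)
Definition C1_diffeo (f finv : M -> M) : Prop :=
  [/\ cancel f finv, cancel finv f, C1_map f & C1_map finv].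

(** The tangent space T_x M is R^n, through the chart [chart_at A x]. Vectors
    are rows, so that linear maps act by multiplication on the right. *)
Definition tangent_map (f : M -> M) (x : M) : 'M[R]_n :=
  'J (chart (chart_at A (f x)) \o f \o chart_inv (chart_at A x))
     (chart (chart_at A x) x).

(** Passage at [x] from coordinates in the chart [c] to coordinates in [d]. *)
Definition coord_change (c d : idx A) (x : M) : 'M[R]_n :=
  'J (chart d \o chart_inv c) (chart c x).

(** [gram x] is the matrix of the inner product of T_x M. On a manifold of class
    C^r the metric tensor is of class C^(r-1), i.e. smooth when r = oo:
    [gram_Cr] says so for its matrix in each chart of the atlas. *)
Record riemannian_metric := {
  gram : M -> 'M[R]_n ;
  gram_sym : forall x, (gram x)^T = gram x ;
  gram_pos : forall x (v : 'rV[R]_n), v != 0 ->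
    0 < (v *m gram x *m v^T) 0 0 ;
  gram_Cr : forall (c : idx A) (k : nat), reg_le k.+1 r ->
    is_Ck k (chart c @` dom c)
      (fun y => let x := chart_inv c y in
                let P := coord_change c (chart_at A x) x in
                P *m gram x *m P^T) }.

Definition rnorm (g : riemannian_metric) (x : M) (v : 'rV[R]_n) : R :=
  Num.sqrt ((v *m gram g x *m v^T) 0 0).

(** Subspaces [E x] of T_x M are given as row spaces. The family is continuous
    when around each point it has a continuous local frame [B], here written
    in the coordinates of a fixed chart. *)
Definition continuous_subbundle (E : M -> 'M[R]_n) : Prop :=
  forall x : M, exists (d : nat) (B : M -> 'M[R]_(d, n)),
    \forall y \near x,
      [/\ dom (chart_at A x) y, {for y, continuous B}, row_free (B y) &
          (E y *m coord_change (chart_at A y) (chart_at A x) y :=: B y)%MS].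

Definition invariant_subbundle (f : M -> M) (E : M -> 'M[R]_n) : Prop :=
  forall x, (E x *m tangent_map f x :=: E (f x))%MS.

Definition splits_tangent (Es Eu : M -> 'M[R]_n) : Prop :=
  forall x, (Es x + Eu x :=: 1%:M)%MS /\ (Es x :&: Eu x)%MS = 0.

Definition anosov (g : riemannian_metric) (f finv : M -> M) : Prop :=
  exists (Es Eu : M -> 'M[R]_n) (C lambda : R),
    [/\ continuous_subbundle Es /\ continuous_subbundle Eu,
        splits_tangent Es Eu,
        invariant_subbundle f Es /\ invariant_subbundle f Eu,
        0 < C /\ 0 < lambda < 1 &
        forall (x : M) (m : nat) (v : 'rV[R]_n),
          ((v <= Es x)%MS ->
             rnorm g (iter m f x) (v *m tangent_map (iter m f) x)
               <= C * lambda ^+ m * rnorm g x v) /\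
          ((v <= Eu x)%MS ->
             rnorm g (iter m finv x) (v *m tangent_map (iter m finv) x)
               <= C * lambda ^+ m * rnorm g x v)].

Definition anosov_realizable (f finv : M -> M) : Prop :=
  exists g : riemannian_metric, anosov g f finv.

End Manifold.

Definition iterz (T : Type) (f finv : T -> T) (m : int) : T -> T :=
  match m with
  | Posz k => iter k f
  | Negz k => iter k.+1 finv
  end.

Definition topologically_expansive (R : realType) (Y : metricType R)
    (h hinv : Y -> Y) : Prop :=
  [/\ cancel h hinv, cancel hinv h, continuous h & continuous hinv] /\
  exists e : Y -> R,
    [/\ continuous e, forall x, 0 < e x &
        forall x y : Y,
          (forall m : int, mdist (iterz h hinv m x) (iterz h hinv m y)
                             < e (iterz h hinv m x)) ->
          x = y].

(* Main.v *)
Require Import Defs.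
From mathcomp Require Import all_boot all_order all_algebra.
From mathcomp Require Import all_classical all_reals all_analysis.
From mathcomp Require Import lra.
Set Implicit Arguments.
Unset Strict Implicit.
Unset Printing Implicit Defensive.
Import Order.TTheory GRing.Theory Num.Theory.
Import numFieldNormedType.Exports.
Local Open Scope classical_set_scope.
Local Open Scope ring_scope.

(** The proof is the classical cone argument, made uniform on a noncompact
    manifold by letting the expansivity radius depend on the point.

    Replace f by F = f^N, with N so large that C * lambda^N <= 1/4; then DF
    contracts E^s and expands E^u by a factor 4 in one step, without any adapted
    metric ([hyperbolic_step]). To a pair (x, y) of close points attach the
    tangent vector v(x, y) at x given by the difference of their coordinates
    ([displacement]), and let S and U be the Riemannian norms of its stable and
    unstable components. Since F is C^1, v(Fx, Fy) = DF_x v(x, y) up to an error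
    that is small compared with v(x, y), so that for y close to x
      S(Fx, Fy) <= S/4 + (S + U)/4   and   U(Fx, Fy) >= 4 U - (S + U)/4.
    If S <= U at (x, y), this persists along the forward orbit and U at least
    doubles at each step ([cone_growth]); as U stays bounded while the orbits
    stay close, U = 0, hence S = 0 and x = y ([one_sided_expansivity]). If
    U <= S, the same argument applies to F^-1, with E^s and E^u exchanged.

    What needs care is the choice of the radius within which the estimates hold,
    as it must be a continuous positive function of x. Two facts provide it.
    A property of small balls that holds locally holds on balls whose radius
    is a positive Lipschitz function of the centre ([lipschitz_radius]); so it
    is enough that the estimates hold for all pairs in some neighbourhood of each
    point. This in turn requires that the charts used for v(x, y) be chosen
    among finitely many near each point; a connected manifold is Lindelof
    ([countable_ball_cover]), which gives such a choice
    ([exists_locally_finite_selection]).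

    Locally the estimates rest on two facts. First, C^1 maps are strictly
    differentiable in charts ([strict_differential]), which bounds the error in
    v(Fx, Fy) uniformly over pairs of points near p. Strict differentials are
    unique and compose, so all chain rules between jacobians follow from them.
    Second, the norm S + U on T_x M is equivalent to the norm of the chart,
    with constants uniform for x near p ([split_norm_equiv_near]), because the
    metric and the two subbundles are continuous. *)

(** * Lipschitz radii and countable covers of connected metric spaces *)

(** The supremum of the radii at most 1 of the balls satisfying [Q] is
    1-Lipschitz, since [ball y (s - d)] lies in [ball x s] when [d] is the
    distance of [x] and [y]. Half of it is a radius that [Q] accepts. *)
Lemma lipschitz_radius (R : realType) (M : metricType R) (Q : set M -> Prop) :
  (forall A B, A `<=` B -> Q B -> Q A) ->
  (forall p : M, exists2 U, nbhs p U & Q U) ->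
  exists e : M -> R, [/\ forall x, 0 < e x,
    forall x y, e x <= e y + mdist x y & forall x, Q (ball x (e x))].
Proof.
move=> Qsub Qloc.
pose S x := [set r : R | 0 < r <= 1 /\ Q (ball x r)].
have Sne x : exists2 r, 0 < r & S x r.
  have [U /nbhs_ballP[r /= r0 rU] QU] := Qloc x.
  have m0 : 0 < Num.min r 1 by rewrite lt_min r0 ltr01.
  exists (Num.min r 1) => //; split; first by rewrite m0 ge_min lexx orbT.
  apply: Qsub QU; apply: subset_trans rU; apply: le_ball.
  by rewrite ge_min lexx.
have Sub x : has_ubound (S x) by exists 1 => r [/andP[]].
have Ssup x : has_sup (S x).
  by split => //; have [r _ Sr] := Sne x; exists r.
have Sle x r : S x r -> r <= sup (S x) by apply: ub_le_sup.
exists (fun x => sup (S x) / 2); split.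
- by move=> x; rewrite divr_gt0//; have [r r0 /Sle] := Sne x; exact: lt_le_trans.
- move=> x y; rewrite -lerBlDr.
  suff : sup (S x) <= sup (S y) + mdist x y.
    have := mdist_ge0 x y; lra.
  apply: ge_sup; first by have [r _ Sr] := Sne x; exists r.
  move=> r [/andP[r0 r1] Qr].
  have [rd|dr] := leP r (mdist x y).
    apply: le_trans rd _; rewrite lerDr.
    by have [t t0 /Sle] := Sne y; move/(le_trans (ltW t0)).
  rewrite -lerBlDr; apply: Sle; split.
    by rewrite subr_gt0 dr lerBlDr (le_trans r1)// lerDl mdist_ge0.
  apply: Qsub Qr => z; rewrite !ballEmdist/= ltrBrDr addrC => h.
  exact: le_lt_trans (metric_triangle x y z) h.
- move=> x; have [r r0 /Sle Sr] := Sne x.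
  have s0 : 0 < sup (S x) / 2 by rewrite divr_gt0// (lt_le_trans r0).
  have [t [/andP[t0 t1] Qt] ht] := sup_adherent s0 (Ssup x).
  by apply: Qsub Qt; apply: le_ball; lra.
Qed.

Lemma lipschitz_continuous (R : realType) (M : metricType R) (e : M -> R) :
  (forall x y, e x <= e y + mdist x y) -> continuous e.
Proof.
move=> eL x; apply/cvgrPdist_lt => r r0.
near=> y.
have : ball x r y by near: y; exact: nbhsx_ballx.
rewrite ballEmdist/= => xy.
have := eL x y; have := eL y x; rewrite (metric_sym y x) => h1 h2.
by rewrite ltr_norml; apply/andP; split; lra.
Unshelve. all: end_near. Qed.

(** A connected space is Lindelof as soon as small balls are separable. The
    points obtained from [x0] by finitely many moves [x |-> g x k], where [g x]
    lists a set that is dense near [x], are countably many. The union of the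
    quarter balls around them is clopen: a point [z] of its closure is in the
    full ball of such a point [x], by the Lipschitz condition on [e], hence some
    [g x k] is so close to [z] that its own quarter ball contains [z]. *)
Lemma countable_ball_cover (R : realType) (M : metricType R)
    (e : M -> R) (g : M -> nat -> M) (x0 : M) :
  connected [set: M] -> (forall x, 0 < e x) ->
  (forall x y, e x <= e y + mdist x y) ->
  (forall x z, ball x (e x) z -> forall r, 0 < r -> exists k, ball z r (g x k)) ->
  exists p : nat -> M, forall x, exists j, ball (p j) (e (p j) / 4) x.
Proof.
move=> Mc e0 eL gd.
pose D := range (fun s : seq nat => foldl g x0 s).
have Dg x k : D x -> D (g x k).
  by move=> [s _ <-]; exists (rcons s k) => //; rewrite foldl_rcons.
pose W := [set z | exists2 x, D x & ball x (e x / 4) z].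
have WT : W = [set: M].
  apply: Mc => //.
  - exists x0; exists x0; first by exists [::].
    by apply: ballxx; rewrite divr_gt0.
  - exists W; last by rewrite setTI.
    rewrite openE => z [x Dx]; rewrite ballEmdist/= => xz.
    have r0 : 0 < e x / 4 - mdist x z by rewrite subr_gt0.
    apply: filterS (nbhsx_ballx z _ r0) => y; rewrite ballEmdist/= => zy.
    exists x => //; rewrite ballEmdist/=.
    by have := metric_triangle x z y; lra.
  - exists W; last by rewrite setTI.
    move=> z zW.
    have /zW[y [[x Dx]]] : nbhs z (ball z (e z / 16)).
      by apply: nbhsx_ballx; rewrite divr_gt0.
    rewrite !ballEmdist/= => xy zy.
    have xz := metric_triangle x y z.
    rewrite (metric_sym y z) in xz.
    have ezx := eL z x; rewrite (metric_sym z x) in ezx.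
    have ex0 := e0 x; have ez0 := e0 z.
    have xez : ball x (e x) z by rewrite ballEmdist/=; lra.
    have ez8 : 0 < e z / 8 by rewrite divr_gt0.
    have [k] := gd _ _ xez _ ez8.
    rewrite ballEmdist/= => zk.
    exists (g x k); first exact: Dg.
    have := eL z (g x k).
    rewrite ballEmdist/= (metric_sym _ z); lra.
exists (fun j => if unpickle j is Some s then foldl g x0 s else x0) => x.
have [_ [s _ <-] xs] : W x by rewrite WT.
by exists (pickle s); rewrite pickleK.
Qed.

(** * Strict differentiability of continuously differentiable maps *)

Lemma mx_entry_le_norm (R : realFieldType) m n (A : 'M[R]_(m, n)) i j :
  `|A i j| <= `|A|.
Proof.
rewrite [leRHS]/Num.Def.normr/= mx_normrE.
exact: (le_bigmax _ (fun ij : 'I_m * 'I_n => `|A ij.1 ij.2|) (i, j)).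
Qed.

Lemma mx_norm_le (R : realFieldType) m n (A : 'M[R]_(m, n)) e :
  0 <= e -> (forall i j, `|A i j| <= e) -> `|A| <= e.
Proof.
move=> e0 Ae; rewrite [leLHS]/Num.Def.normr/= mx_normrE.
by apply: bigmax_le => // -[i j] _; exact: Ae.
Qed.

Lemma norm_mulmx_le (R : realFieldType) m n p (A : 'M[R]_(m, n))
    (B : 'M[R]_(n, p)) : `|A *m B| <= n%:R * `|A| * `|B|.
Proof.
apply: mx_norm_le => [|i j]; first by rewrite !mulr_ge0.
rewrite mxE (le_trans (ler_norm_sum _ _ _))//.
rewrite (@le_trans _ _ (\sum_(k < n) `|A| * `|B|))//.
  by apply: ler_sum => k _; rewrite normrM ler_pM// mx_entry_le_norm.
by rewrite sumr_const card_ord -mulrA mulr_natl.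
Qed.

Lemma is_derive_line (R : realFieldType) (V W : normedModType R) (h : V -> W)
    (z v : V) (t : R) : differentiable h (t *: v + z) ->
  is_derive t 1 (fun s => h (s *: v + z)) ('D_v h (t *: v + z)).
Proof.
move=> /(@diff_derivable _ _ _ _ _ v) dh.
have E : (fun s : R => s^-1 *: (((fun s => h (s *: v + z)) \o shift t) (s *: 1)
            - h (t *: v + z))) =
    (fun s => s^-1 *: ((h \o shift (t *: v + z)) (s *: v) - h (t *: v + z))).
  apply/funext => s /=; congr (_ *: (h _ - _)).
  by rewrite [s%:A]mulr1 scalerDl addrA.
by split; rewrite /derivable /derive E.
Qed.

(** The mean value theorem applied, coordinate by coordinate, to
    [h - 'J h a] on the segment from [z] to [w]; the derivative there is small
    because the partial derivatives of [h] are continuous at [a]. *)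
Lemma strict_differential_bound (R : realType) m n (h : 'rV[R]_m -> 'rV[R]_n)
    (U : set 'rV[R]_m) (a : 'rV[R]_m) : nbhs a U ->
  {in U, forall x, differentiable h x} ->
  (forall v, {for a, continuous (fun x => 'D_v h x)}) ->
  forall e, 0 < e -> exists2 B, nbhs a B & forall z w, B z -> B w ->
    `|(h w - h z) - (w - z) *m 'J h a| <= e * `|w - z|.
Proof.
move=> aU dU cD e e0.
pose e' := e / m.+1%:R.
have e'0 : 0 < e' by rewrite divr_gt0.
have : \forall x \near a, U x /\
    forall k : 'I_m, `|'D_(delta_mx 0 k) h a - 'D_(delta_mx 0 k) h x| < e'.
  apply: filterI => //.
  have Dnear (k : 'I_m) : \forall x \near a,
      `|'D_(delta_mx 0 k) h a - 'D_(delta_mx 0 k) h x| < e'.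
    by have /cvgrPdist_lt/(_ _ e'0) := cD (delta_mx 0 k).
  exact: (filter_forall _ Dnear).
move=> /nbhs_ballP[d /= d0 dB].
exists (ball a d); first exact: nbhsx_ballx.
move=> z w az aw.
apply: mx_norm_le => [|i j]; first by rewrite mulr_ge0// ltW.
rewrite (ord1 i) {i}.
set v := w - z.
pose phi t := h (t *: v + z) 0 j - t * (v *m 'J h a) 0 j.
pose dphi t := (v *m 'J h (t *: v + z)) 0 j - (v *m 'J h a) 0 j.
have inB (t : R) : 0 <= t <= 1 -> ball a d (t *: v + z).
  move: az aw; rewrite -!ball_normE /= => az aw /andP[t0 t1].
  have -> : a - (t *: v + z) = t *: (a - w) + (1 - t) *: (a - z).
    by apply/rowP => k; rewrite /v !mxE; lra.
  apply: le_lt_trans (ler_normD _ _) _; rewrite !normrZ ger0_norm//.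
  rewrite [`|1 - t|]ger0_norm ?subr_ge0//.
  have [->|tn0] := eqVneq t 0; first by rewrite mul0r add0r subr0 mul1r.
  have {}t0 : 0 < t by rewrite lt_neqAle eq_sym tn0.
  have : t * `|a - w| < t * d by rewrite ltr_pM2l.
  have : (1 - t) * `|a - z| <= (1 - t) * d.
    by rewrite ler_wpM2l ?subr_ge0// ltW.
  lra.
have dphiP (t : R) : 0 <= t <= 1 -> is_derive t 1 phi (dphi t).
  move=> t01; have [Ut _] := dB _ (inB _ t01).
  have dh : differentiable h (t *: v + z) by apply: dU; rewrite inE.
  have [d1 d2] := is_derive_line dh.
  have dj : is_derive t 1 (fun s => h (s *: v + z) 0 j)
              ((v *m 'J h (t *: v + z)) 0 j).
    split; first exact: (derivable_mxP _ _ _).1 d1 0 j.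
    rewrite -deriveEjacobian// -d2 derive_mx// mxE//.
  have dl : is_derive t 1 (fun s => s * (v *m 'J h a) 0 j) ((v *m 'J h a) 0 j).
    set b := (v *m 'J h a) 0 j.
    have -> : (fun s => s * b) = b *: (@id R) by apply/funext => s; exact: mulrC.
    by apply: is_derive_eq; rewrite [_ *: _]mulr1.
  have E : phi = (fun s => h (s *: v + z) 0 j) -
      (fun s => s * (v *m 'J h a) 0 j) by apply/funext.
  by rewrite E; exact: (is_deriveB dj dl).
have [c] : exists2 c, c \in `]0, 1[%R & phi 1 - phi 0 = dphi c * (1 - 0).
  apply: MVT => //.
    by move=> x; rewrite in_itv/= => /andP[x0 x1]; apply: dphiP; rewrite !ltW.
  apply: derivable_within_continuous => x; rewrite in_itv/= => /dphiP [] //.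
rewrite in_itv/= => /andP[c0 c1].
rewrite subr0 mulr1 /phi scale1r scale0r mul1r mul0r subr0 add0r /v subrK -/v.
move=> E.
have -> : (h w - h z - v *m 'J h a) 0 j =
    (v *m ('J h (c *: v + z) - 'J h a)) 0 j.
  have -> : (v *m ('J h (c *: v + z) - 'J h a)) 0 j = dphi c.
    by rewrite /dphi mulmxBr [LHS]mxE [X in _ + X]mxE.
  rewrite -E [LHS]mxE [X in X + _]mxE [X in _ + X + _]mxE [X in _ + X]mxE.
  by rewrite addrAC.
have c01 : 0 <= c <= 1 by rewrite !ltW.
have [Uc Dc] := dB _ (inB _ c01).
apply: le_trans (mx_entry_le_norm _ _ _) _.
apply: le_trans (norm_mulmx_le _ _) _.
rewrite mulrAC ler_wpM2r//.
have m1 : e = m.+1%:R * e' by rewrite /e' mulrC divfK// pnatr_eq0.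
rewrite m1; apply: ler_pM => //; first by rewrite ler_nat.
apply: mx_norm_le => [|i k]; first exact: ltW.
have dh : differentiable h (c *: v + z) by apply: dU; rewrite inE.
have da : differentiable h a by apply: dU; rewrite inE; exact: nbhs_singleton.
have := Dc i; rewrite distrC !deriveEjacobian// -mulmxBr => /ltW.
apply: le_trans; rewrite -rowE.
by have := mx_entry_le_norm (row i ('J h (c *: v + z) - 'J h a)) 0 k; rewrite mxE.
Qed.

(** * Strict differentials in charts *)

Section StrictDifferentials.
Context {R : realType} {r : regularity} {n : nat} {M : metricType R}.
Variable A : atlas r n M.
Implicit Types (i j k : idx A) (F G : M -> M) (p x y : M) (L : 'M[R]_n).

Lemma dom_nbhs i p : dom i p -> nbhs p (dom i).
Proof. by move=> ip; apply: open_nbhs_nbhs; split => //; exact: dom_open. Qed.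

Lemma chart_cts i p : dom i p -> {for p, continuous (chart i)}.
Proof. by move=> ip; apply: chart_continuous; rewrite inE. Qed.

Lemma chartKin i p : dom i p -> chart_inv i (chart i p) = p.
Proof. by move=> ip; apply: (chartK (c := i)); rewrite inE. Qed.

Lemma chart_inj i x y : dom i x -> dom i y -> chart i x = chart i y -> x = y.
Proof. by move=> ix iy E; rewrite -(chartKin ix) E chartKin. Qed.

Lemma chart_inv_cts i p : dom i p ->
  {for chart i p, continuous (chart_inv i)}.
Proof.
by move=> ip; apply: (chart_inv_continuous (c := i)); rewrite inE; exists p.
Qed.

Lemma nbhs_codom i p : dom i p -> nbhs (chart i p) (chart i @` dom i).
Proof.
by move=> ip; apply: open_nbhs_nbhs; split; [exact: codom_open|exists p].
Qed.

Lemma nbhs_chart_image i p (U : set M) : dom i p -> nbhs p U ->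
  nbhs (chart i p) (chart i @` (dom i `&` U)).
Proof.
move=> ip pU.
have : nbhs (chart i p) (chart_inv i @^-1` U).
  by apply: chart_inv_cts => //; rewrite chartKin.
apply: filterS2 (nbhs_codom ip) => _ [y iy <-] /=.
by rewrite chartKin// => Uy; exists y.
Qed.

(** The estimate is required for all pairs of points near [p], and not only for
    the pairs containing [p]: this is what makes it uniform in the base point
    and, at the same time, stable under composition without any reference to
    derivatives at points other than [p]. *)
Definition strict_differential i j F p L : Prop :=
  [/\ dom i p, dom j (F p), {for p, continuous F} &
    forall e, 0 < e -> exists2 U, nbhs p U & forall x y, U x -> U y ->
      `|(chart j (F y) - chart j (F x)) - (chart i y - chart i x) *m L|
        <= e * `|chart i y - chart i x|].

Lemma is_Ck1_strict_differential i j F p : {for p, continuous F} ->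
  dom i p -> dom j (F p) ->
  is_Ck 1 (chart i @` (dom i `&` F @^-1` dom j))
    (chart j \o F \o chart_inv i) ->
  strict_differential i j F p
    ('J (chart j \o F \o chart_inv i) (chart i p)).
Proof.
move=> Fc ip jFp [dU cD]; split => // e e0.
have V : nbhs p (F @^-1` dom j) by apply: Fc; exact: dom_nbhs.
have aU := nbhs_chart_image ip V.
have [|B aB HB] := strict_differential_bound aU dU _ e0.
  by move=> v; apply: cD; rewrite inE; exact: nbhs_singleton.
exists (dom i `&` chart i @^-1` B).
  by apply: filterI; [exact: dom_nbhs|exact: chart_cts].
move=> x y [ix Bx] [iy By]; have := HB _ _ Bx By.
by rewrite /= !chartKin.
Qed.

Lemma C1_strict_differential F i j p : C1_map A F -> dom i p -> dom j (F p) ->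
  strict_differential i j F p
    ('J (chart j \o F \o chart_inv i) (chart i p)).
Proof.
by move=> [Fc FC1] ip jp; apply: is_Ck1_strict_differential (FC1 i j) => //;
  exact: Fc.
Qed.

Lemma strict_differential_coord_change (hr : reg_le 1 r) i j p :
  dom i p -> dom j p ->
  strict_differential i j idfun p (coord_change i j p).
Proof.
move=> ip jp; apply: is_Ck1_strict_differential => //.
exact: transition_Cr.
Qed.

Lemma strict_differential_id i p : dom i p ->
  strict_differential i i idfun p 1%:M.
Proof.
move=> ip; split => // e e0; exists setT; first exact: filterT.
by move=> x y _ _; rewrite mulmx1 subrr normr0 mulr_ge0// ltW.
Qed.

Lemma strict_differential_comp i j k F G p L L' :
  strict_differential i j F p L -> strict_differential j k G (F p) L' ->
  strict_differential i k (G \o F) p (L *m L').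
Proof.
move=> [ip jp Fc FL] [_ kp Gc GL']; split => //.
  by apply: continuous_comp.
move=> e e0.
pose K := 1 + n%:R * `|L|.
have K0 : 0 < K by rewrite ltr_pwDl// mulr_ge0.
pose K' := 1 + n%:R * `|L'|.
have K'0 : 0 < K' by rewrite ltr_pwDl// mulr_ge0.
(* The bound by 1 only serves to get [`|v| <= K * `|u|]. *)
pose d := Num.min 1 (e / (2 * K')).
have d0 : 0 < d by rewrite lt_min ltr01 divr_gt0// mulr_gt0.
have d'0 : 0 < e / (2 * K) by rewrite divr_gt0// mulr_gt0.
have [U pU HU] := FL _ d0.
have [V pV HV] := GL' _ d'0.
exists (U `&` F @^-1` V); first by apply: filterI => //; exact: Fc.
move=> x y [Ux Vx] [Uy Vy].
have := HU _ _ Ux Uy; have := HV _ _ Vx Vy => /=.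
set u := chart i y - chart i x; set v := chart j (F y) - chart j (F x).
set w := chart k _ - chart k _ => Hw Hv.
clearbody u v w.
have vle : `|v| <= K * `|u|.
  rewrite -[v](subrK (u *m L)) (le_trans (ler_normD _ _))//.
  rewrite mulrDl mul1r lerD//.
    by rewrite (le_trans Hv)// ler_piMl// ge_min lexx.
  by rewrite (le_trans (norm_mulmx_le _ _))// mulrAC.
have -> : w - u *m (L *m L') = (w - v *m L') + (v - u *m L) *m L'.
  by rewrite mulmxBl mulmxA subrKA.
rewrite (le_trans (ler_normD _ _))// (splitr e) mulrDl lerD//.
  rewrite (le_trans Hw)//.
  have -> : e / 2 = e / (2 * K) * K by rewrite invfM mulrA divfK ?gt_eqF.
  by rewrite -[leRHS]mulrA ler_wpM2l// ltW.
rewrite (le_trans (norm_mulmx_le _ _))//.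
rewrite -mulrA mulrCA.
apply: (@le_trans _ _ (d * `|u| * K')).
  by rewrite ler_pM// ?mulr_ge0// lerDr.
rewrite mulrAC ler_wpM2r//.
apply: (@le_trans _ _ (e / (2 * K') * K')).
  by rewrite ler_wpM2r ?ge_min ?lexx ?orbT// ltW.
by rewrite invfM mulrA divfK ?gt_eqF.
Qed.

(** Strict differentials are continuous: at [x] close to [p] the estimates at
    [x] and at [p] both apply to the pair formed by [x] and the point of
    coordinates [chart i x + t *: u], for small [t], and comparing them bounds
    [u *m (L' - L)] by homogeneity. *)
Lemma strict_differential_near i j F p L e :
  strict_differential i j F p L -> 0 < e ->
  \forall x \near p, forall L', strict_differential i j F x L' ->
    forall u : 'rV[R]_n, `|u *m (L' - L)| <= e * `|u|.
Proof.
move=> [_ _ _ FL] e0.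
have e2 : 0 < e / 2 by rewrite divr_gt0.
have [U pU HU] := FL _ e2.
move: pU; rewrite nbhsE => -[W [Wo Wp] WU].
apply: filterS (open_nbhs_nbhs (conj Wo Wp)) => x Wx L' [ix jx _ FL'] u.
have [V xV HV] := FL' _ e2.
have xOV : nbhs x (W `&` V) by apply: filterI => //; exact: open_nbhs_nbhs.
have /nbhs_ballP[d /= d0 dB] := nbhs_chart_image ix xOV.
(* The denominator is shifted by 1 as [u] may vanish. *)
pose t := d / (1 + `|u|).
have t0 : 0 < t by rewrite divr_gt0// ltr_pwDl.
have [y [iy [Wy Vy]] Ey] : (chart i @` (dom i `&` (W `&` V))) (chart i x + t *: u).
  apply: dB; rewrite -ball_normE /= opprD addNKr normrN normrZ gtr0_norm//.
  by rewrite mulrAC ltr_pdivrMr ?ltr_pwDl// ltr_pM2l// ltr_pwDl.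
have := HU _ _ (WU _ Wx) (WU _ Wy).
have := HV _ _ (nbhs_singleton xV) Vy.
rewrite Ey [chart i x + _]addrC addrK.
set v := chart j _ - _ => H1 H2.
have E : t *: (u *m (L' - L)) =
    - (v - (t *: u) *m L') + (v - (t *: u) *m L).
  by rewrite opprB addrA subrK -mulmxBr scalemxAl.
have tZ (w : 'rV[R]_n) : `|t *: w| = t * `|w| by rewrite normrZ gtr0_norm.
rewrite -(ler_pM2l t0) -tZ E (le_trans (ler_normD _ _))// normrN.
by rewrite mulrCA -tZ (splitr e) mulrDl lerD.
Qed.

Lemma strict_differential_unique i j F p L L' :
  strict_differential i j F p L -> strict_differential i j F p L' -> L = L'.
Proof.
move=> FL FL'; apply/eqP; rewrite eq_sym -subr_eq0; apply/eqP/row_matrixP => m.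
rewrite row0 rowE; apply/eqP; rewrite -normr_le0; apply/ler_addgt0Pl => e e0.
rewrite addr0; pose u : 'rV[R]_n := delta_mx 0 m.
have e'0 : 0 < e / (1 + `|u|) by rewrite divr_gt0// ltr_pwDl.
have /nbhs_singleton/(_ _ FL' u) := strict_differential_near FL e'0.
move=> /le_trans; apply; rewrite mulrAC ler_pdivrMr ?ltr_pwDl//.
by rewrite ler_pM2l// lerDr.
Qed.

(** A strict differential is in particular the differential of the map read in
    charts. Together with uniqueness and composition it turns every identity
    between jacobians into an identity between maps. *)
Lemma strict_differential_jacobian i j F p L :
  strict_differential i j F p L ->
  'J (chart j \o F \o chart_inv i) (chart i p) = L.
Proof.
move=> [ip jp Fc FL]; set h := chart j \o F \o chart_inv i.
suff E : 'd h (chart i p) = mulmxr L :> ('rV[R]_n -> 'rV[R]_n).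
  apply/row_matrixP => m; rewrite !rowE mul_rV_lin1.
  by rewrite -[LHS]/('d h (chart i p) _) E.
apply: diff_unique.
  move=> x; apply/(@cvgrPdist_le _ _ _ _ (nbhs_filter x)) => e e0.
  pose K := 1 + n%:R * `|L|.
  have K0 : 0 < K by rewrite ltr_pwDl// mulr_ge0.
  have e'0 : 0 < e / K by rewrite divr_gt0.
  apply/nbhs_ballP; exists (e / K) => // y; rewrite -ball_normE /= => /ltW xy.
  rewrite -mulmxBl (le_trans (norm_mulmx_le _ _))// mulrAC.
  apply: (@le_trans _ _ (K * `|x - y|)); first by rewrite ler_wpM2r// lerDr.
  by rewrite mulrC -ler_pdivlMr.
apply/eqaddoP => e e0.
have [U pU HU] := FL _ e0.
have /nbhs_ballP[d /= d0 dB] := nbhs_chart_image ip pU.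
apply/nbhs_ballP; exists d => // u; rewrite -ball_normE /= sub0r normrN => ud.
have [y [iy Uy] Ey] : (chart i @` (dom i `&` U)) (u + chart i p).
  by apply: dB; rewrite -ball_normE /= opprD addrCA subrr addr0 normrN.
have := HU _ _ (nbhs_singleton pU) Uy; rewrite Ey addrK.
congr (`| _ | <= _).
rewrite /h /= chartKin//.
rewrite [RHS](_ : _ = chart j (F (chart_inv i (u + chart i p))) -
  (chart j (F p) + u *m L))//.
by rewrite -Ey chartKin// opprD addrA.
Qed.
End StrictDifferentials.

(** * Norms of inner products and components in moving frames *)

Section QuadraticNorm.
Context {R : realType} {n : nat}.
Implicit Types (G : 'M[R]_n) (u v w : 'rV[R]_n).

Definition bform G u v : R := (u *m G *m v^T) 0 0.

Definition qnorm G u : R := Num.sqrt (bform G u u).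

Lemma bformDl G u v w : bform G (u + v) w = bform G u w + bform G v w.
Proof. by rewrite /bform !mulmxDl mxE. Qed.

Lemma bformDr G u v w : bform G w (u + v) = bform G w u + bform G w v.
Proof. by rewrite /bform linearD mulmxDr mxE. Qed.

Lemma bformZl G a u v : bform G (a *: u) v = a * bform G u v.
Proof. by rewrite /bform -!scalemxAl mxE. Qed.

Lemma bformZr G a u v : bform G u (a *: v) = a * bform G u v.
Proof. by rewrite /bform linearZ -scalemxAr mxE. Qed.

Lemma bform0 G v : bform G 0 v = 0.
Proof. by rewrite /bform !mul0mx mxE. Qed.

Lemma qnormN G u : qnorm G (- u) = qnorm G u.
Proof.
by rewrite /qnorm -scaleN1r bformZl bformZr !mulN1r opprK.
Qed.

Lemma qnorm_ge0 G u : 0 <= qnorm G u.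
Proof. exact: sqrtr_ge0. Qed.

Definition inner_product G : Prop :=
  G^T = G /\ forall v, v != 0 -> 0 < bform G v v.

Lemma bformC G u v : G^T = G -> bform G u v = bform G v u.
Proof.
move=> Gs; rewrite /bform.
have -> : (v *m G *m u^T) 0 0 = (v *m G *m u^T)^T 0 0 by rewrite [RHS]mxE.
by rewrite !trmx_mul trmxK Gs mulmxA.
Qed.

Lemma bform_ge0 G v : inner_product G -> 0 <= bform G v v.
Proof.
by case=> _ Gp; have [->|/Gp/ltW//] := eqVneq v 0; rewrite bform0.
Qed.

Lemma bform_cauchy_schwarz G u v : inner_product G ->
  bform G u v ^+ 2 <= bform G u u * bform G v v.
Proof.
move=> GI; have [Gs Gp] := GI.
have [->|/Gp c0] := eqVneq v 0.
  by rewrite (bformC _ _ Gs) !bform0 expr0n/= mulr0.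
set a := bform G u u; set b := bform G u v; set c := bform G v v in c0 *.
have := bform_ge0 (c *: u + (- b) *: v) GI.
rewrite !(bformDl, bformDr, bformZl, bformZr) (bformC v u Gs) -/a -/b -/c => h.
have : 0 <= c * (a * c - b ^+ 2) by move: h; rewrite expr2; lra.
by rewrite pmulr_rge0// subr_ge0.
Qed.

Lemma qnormD G u v : inner_product G -> qnorm G (u + v) <= qnorm G u + qnorm G v.
Proof.
move=> GI; have [Gs Gp] := GI.
have su : qnorm G u ^+ 2 = bform G u u by rewrite sqr_sqrtr// bform_ge0.
have sv : qnorm G v ^+ 2 = bform G v v by rewrite sqr_sqrtr// bform_ge0.
have suv : qnorm G (u + v) ^+ 2 = bform G (u + v) (u + v).
  by rewrite sqr_sqrtr// bform_ge0.
rewrite -(ler_pXn2r (n := 2))// ?nnegrE ?addr_ge0 ?qnorm_ge0//.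
rewrite suv sqrrD su sv bformDl !bformDr (bformC v u Gs).
suff : bform G u v <= qnorm G u * qnorm G v by lra.
apply: le_trans (ler_norm _) _.
rewrite -(ler_pXn2r (n := 2))// ?nnegrE ?mulr_ge0 ?qnorm_ge0//.
by rewrite exprMn su sv real_normK ?num_real// bform_cauchy_schwarz.
Qed.

Lemma bform_norm_le G u v : `|bform G u v| <= n%:R ^+ 2 * `|G| * `|u| * `|v|.
Proof.
have vT : `|v^T| <= `|v|.
  by apply: mx_norm_le => // i j; rewrite mxE mx_entry_le_norm.
rewrite (le_trans (mx_entry_le_norm _ _ _))//.
rewrite (le_trans (norm_mulmx_le _ _))//.
apply: ler_pM => //.
rewrite expr2 -!mulrA ler_wpM2l// (le_trans (norm_mulmx_le _ _))//.
by rewrite -mulrA [`|G| * _]mulrC.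
Qed.

(** The coordinate [u 0 i] is the inner product of [u] with
    [f i = e_i G^-1], so the Cauchy-Schwarz inequality bounds it. *)
Lemma inner_product_lower_bound G : inner_product G ->
  exists2 a, 0 < a & forall u, a * `|u| ^+ 2 <= bform G u u.
Proof.
move=> GI; have [Gs Gp] := GI.
have Gu : G \in unitmx.
  rewrite -row_free_unit -kermx_eq0; apply/eqP/row_matrixP => i; rewrite row0.
  apply/eqP; apply: contraT => /Gp; rewrite /bform.
  have /sub_kermxP -> : (row i (kermx G) <= kermx G)%MS by exact: row_sub.
  by rewrite mul0mx mxE ltxx.
pose f i : 'rV[R]_n := delta_mx 0 i *m invmx G.
have fE u i : bform G u (f i) = u 0 i.
  rewrite /bform /f trmx_mul trmx_inv Gs mulmxA mulmxK// trmx_delta.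
  by rewrite -colE mxE.
pose S := 1 + \sum_i bform G (f i) (f i).
have S0 : 0 < S by rewrite ltr_pwDl// sumr_ge0// => i _; exact: bform_ge0.
exists S^-1; first by rewrite invr_gt0.
move=> u; rewrite mulrC ler_pdivrMr//.
have qS0 : 0 <= bform G u u * S by rewrite mulr_ge0 ?bform_ge0// ltW.
rewrite -(sqr_sqrtr qS0) ler_pXn2r// ?nnegrE ?sqrtr_ge0//.
apply: mx_norm_le => [|i j]; first exact: sqrtr_ge0.
rewrite -sqrtr_sqr ler_sqrt// (ord1 i) -fE.
apply: le_trans (bform_cauchy_schwarz _ _ GI) _.
rewrite ler_wpM2l ?bform_ge0// /S (bigD1 j)//=.
have : 0 <= \sum_(k < n | k != j) bform G (f k) (f k).
  by apply: sumr_ge0 => k _; exact: bform_ge0.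
lra.
Qed.

(** The constant [K] does not depend on [G'], so that it serves for all points
    near a given one when [G'] is the matrix of a continuous metric. *)
Lemma qnorm_equiv_near G : inner_product G ->
  exists K e : R, [/\ 0 < K, 0 < e & forall G', `|G' - G| <= e ->
    forall u, `|u| <= K * qnorm G' u /\ qnorm G' u <= K * `|u|].
Proof.
move=> /inner_product_lower_bound[a a0 Ga].
pose N : R := 1 + n%:R ^+ 2.
have N0 : 0 < N by rewrite ltr_pwDl// exprn_ge0.
pose e := a / (2 * N).
have e0 : 0 < e by rewrite divr_gt0// mulr_gt0.
pose b := N * (`|G| + e).
have b0 : 0 < b by rewrite mulr_gt0// ltr_wpDl.
pose K2 := 2 / a + b.
have K20 : 0 < K2 by rewrite addr_gt0// divr_gt0.
exists (Num.sqrt K2), e; split => //; first by rewrite sqrtr_gt0.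
move=> G' G'G u.
have NG H v : `|bform H v v| <= N * `|H| * `|v| ^+ 2.
  apply: le_trans (bform_norm_le _ _ _) _.
  rewrite -mulrA -expr2 ler_wpM2r ?exprn_ge0// ler_wpM2r//.
  by rewrite /N lerDr.
have lo : a / 2 * `|u| ^+ 2 <= bform G' u u.
  have E : bform G' u u = bform G u u + bform (G' - G) u u.
    rewrite /bform -[X in _ = X + _]/(bform G u u) /bform.
    by rewrite mulmxBr mulmxBl [X in _ + X]mxE [X in _ + (_ + X)]mxE addrC subrK.
  have h1 := Ga u; have := NG (G' - G) u; rewrite ler_norml => /andP[h2 _].
  have h3 : N * `|G' - G| * `|u| ^+ 2 <= a / 2 * `|u| ^+ 2.
    rewrite ler_wpM2r ?exprn_ge0//.
    apply: (@le_trans _ _ (N * e)); first by rewrite ler_wpM2l// ltW.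
    by rewrite /e invfM mulrCA mulrA mulrAC mulrA divfK ?gt_eqF// lexx.
  rewrite E; lra.
have up : bform G' u u <= b * `|u| ^+ 2.
  apply: le_trans (ler_norm _) _; apply: le_trans (NG _ _) _.
  rewrite ler_wpM2r ?exprn_ge0// ler_wpM2l ?(ltW N0)//.
  rewrite -[G'](subrK G) (le_trans (ler_normD _ _))// addrC lerD//.
have q0 : 0 <= bform G' u u.
  by apply: le_trans lo; rewrite mulr_ge0 ?exprn_ge0// divr_ge0// ltW.
have nu : `|u| = Num.sqrt (`|u| ^+ 2) by rewrite sqrtr_sqr ger0_norm.
split.
  rewrite [leLHS]nu /qnorm -sqrtrM; last exact: ltW.
  rewrite ler_sqrt; last by rewrite mulr_ge0// ltW.
  apply: (@le_trans _ _ (2 / a * bform G' u u)).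
    by rewrite -ler_pdivrMl ?divr_gt0// invf_div.
  by rewrite ler_wpM2r// lerDl ltW.
rewrite nu /qnorm -sqrtrM; last exact: ltW.
rewrite ler_sqrt; last by rewrite mulr_ge0 ?exprn_ge0// ltW.
apply: le_trans up _; rewrite ler_wpM2r ?exprn_ge0// lerDr.
by rewrite divr_ge0// ltW.
Qed.

End QuadraticNorm.

(** A right inverse of the full frame recovers the coefficients [(a, b)] from
    the sum, with a bound that survives a small perturbation of the frame. This
    bounds the projections on two transverse subbundles locally uniformly. *)
Lemma frame_components_bound (R : realType) d1 d2 n
    (B1 : 'M[R]_(d1, n)) (B2 : 'M[R]_(d2, n)) : row_free (col_mx B1 B2) ->
  exists K e : R, [/\ 0 < K, 0 < e & forall B1' B2',
    `|B1' - B1| <= e -> `|B2' - B2| <= e ->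
    forall (a : 'rV[R]_d1) (b : 'rV[R]_d2),
      `|a *m B1'| <= K * `|a *m B1' + b *m B2'| /\
      `|b *m B2'| <= K * `|a *m B1' + b *m B2'|].
Proof.
move=> free; set D := col_mx B1 B2 in free *.
pose k := 1 + n%:R * `|pinvmx D|.
have k0 : 0 < k by rewrite ltr_pwDl// mulr_ge0.
pose N : R := 1 + (d1 + d2)%:R.
have N0 : 0 < N by rewrite ltr_pwDl.
have Dk (w : 'rV[R]_(d1 + d2)) : `|w| <= k * `|w *m D|.
  rewrite -[w in leLHS]mulmx1 -(mulmxVp free) mulmxA.
  rewrite (le_trans (norm_mulmx_le _ _))// mulrAC ler_wpM2r// /k.
  by rewrite lerDr.
pose e := (2 * k * N)^-1.
have e0 : 0 < e by rewrite invr_gt0 !mulr_gt0.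
pose m := `|B1| + `|B2| + e.
have m0 : 0 < m by rewrite ltr_wpDl// addr_ge0.
exists (N * (2 * k) * m), e; split => //; first by rewrite !mulr_gt0.
move=> B1' B2' H1 H2 a b.
pose w := row_mx a b; pose D' := col_mx B1' B2'.
have wD' : w *m D' = a *m B1' + b *m B2' by rewrite mul_row_col.
rewrite -wD'.
have DD : `|D' - D| <= e.
  rewrite /D' /D opp_col_mx add_col_mx; apply: mx_norm_le => [|i j].
    exact: ltW.
  by case: (split_ordP i) => i' ->; rewrite ?(col_mxEu, col_mxEd);
    exact: le_trans (mx_entry_le_norm _ _ _) _.
have wb : `|w| <= 2 * k * `|w *m D'|.
  have h1 := Dk w.
  have h2 : `|w *m D| <= `|w *m D'| + `|w *m (D' - D)|.
    by rewrite mulmxBr -[X in `|X| <= _](subKr (w *m D')) ler_normB.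
  have h3 : k * `|w *m (D' - D)| <= `|w| / 2.
    apply: (@le_trans _ _ (k * (N * `|w| * e))).
      rewrite ler_wpM2l ?(ltW k0)// (le_trans (norm_mulmx_le _ _))//.
      by rewrite ler_pM ?mulr_ge0// ler_wpM2r// lerDr.
    rewrite /e !invfM.
    have -> : k * (N * `|w| * (2^-1 * k^-1 * N^-1)) =
      (k / k) * (N / N) * (`|w| / 2) by lra.
    by rewrite !divff ?gt_eqF// !mul1r.
  have h4 : k * `|w *m D| <= k * `|w *m D'| + k * `|w *m (D' - D)|.
    by rewrite -mulrDr ler_wpM2l// ltW.
  lra.
have aw : `|a| <= `|w|.
  apply: mx_norm_le => // i j.
  by have := mx_entry_le_norm w i (lshift _ j); rewrite row_mxEl.
have bw : `|b| <= `|w|.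
  apply: mx_norm_le => // i j.
  by have := mx_entry_le_norm w i (rshift _ j); rewrite row_mxEr.
have B1m : `|B1'| <= m.
  rewrite -[B1'](subrK B1) (le_trans (ler_normD _ _))//.
  by rewrite /m; have := normr_ge0 B2; lra.
have B2m : `|B2'| <= m.
  rewrite -[B2'](subrK B2) (le_trans (ler_normD _ _))//.
  by rewrite /m; have := normr_ge0 B1; lra.
have fin d (c : 'rV[R]_d) (B : 'M[R]_(d, n)) : (d <= d1 + d2)%N ->
    `|c| <= `|w| -> `|B| <= m -> `|c *m B| <= N * (2 * k) * m * `|w *m D'|.
  move=> dN cw Bm; apply: le_trans (norm_mulmx_le _ _) _.
  rewrite [leRHS]mulrAC; apply: ler_pM => //.
  rewrite -mulrA; apply: ler_pM => //; last exact: le_trans wb.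
  by rewrite (@le_trans _ _ (d1 + d2)%:R) ?ler_nat// lerDr.
by split; apply: fin; rewrite ?leq_addr ?leq_addl.
Qed.

(** * Local comparison of the chart norm with the hyperbolic norm *)

Section LocalBounds.
Context {R : realType} {r : regularity} {n : nat} {M : metricType R}.
Variables (A : atlas r n M) (hr : reg_le 1 r).
Implicit Types (i j k : idx A) (p x : M).

Local Notation frame x := (chart_at A x).

Lemma coord_change_trans i j k x : dom i x -> dom j x -> dom k x ->
  coord_change i j x *m coord_change j k x = coord_change i k x.
Proof.
move=> ix jx kx.
have D1 := strict_differential_coord_change hr ix jx.
have D2 := strict_differential_coord_change hr jx kx.
exact: strict_differential_unique (strict_differential_comp D1 D2)
  (strict_differential_coord_change hr ix kx).
Qed.

Lemma coord_change_id i x : dom i x -> coord_change i i x = 1%:M.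
Proof.
move=> ix; apply: strict_differential_unique (strict_differential_id ix).
exact: strict_differential_coord_change.
Qed.

Lemma coord_changeK i j x : dom i x -> dom j x ->
  coord_change i j x *m coord_change j i x = 1%:M.
Proof. by move=> ix jx; rewrite coord_change_trans// coord_change_id. Qed.

Lemma coord_change_bound i j p : dom i p -> dom j p ->
  exists2 K : R, 0 < K & \forall x \near p, forall u : 'rV[R]_n,
    `|u *m coord_change i j x| <= K * `|u|.
Proof.
move=> ip jp; pose L := coord_change i j p.
exists (1 + n%:R * `|L|); first by rewrite ltr_pwDl// mulr_ge0.
have pL := strict_differential_near
  (strict_differential_coord_change hr ip jp) ltr01.
near=> x => u.
have ix : dom i x by near: x; exact: dom_nbhs.
have jx : dom j x by near: x; exact: dom_nbhs.
have xL : `|u *m (coord_change i j x - L)| <= 1 * `|u|.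
  by apply: (near pL x) => //; exact: strict_differential_coord_change.
rewrite -[coord_change i j x](subrK L) mulmxDr (le_trans (ler_normD _ _))//.
rewrite mulrDl lerD// (le_trans (norm_mulmx_le _ _))//.
by rewrite mulrAC.
Unshelve. all: by end_near. Qed.

Variable g : riemannian_metric A.

Lemma gram_inner_product x : inner_product (gram g x).
Proof. by split; [exact: gram_sym | move=> v; exact: gram_pos]. Qed.

Lemma rnormD x v w : rnorm g x (v + w) <= rnorm g x v + rnorm g x w.
Proof. exact: qnormD (gram_inner_product x). Qed.

Lemma rnormN x v : rnorm g x (- v) = rnorm g x v.
Proof. exact: qnormN. Qed.

Lemma rnorm_ge0 x v : 0 <= rnorm g x v.
Proof. exact: qnorm_ge0. Qed.

(** The matrix [H x] of the metric in the fixed chart [i] is a continuous function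
    of [x], whereas [gram g x] is read in a frame that may jump with [x]. *)
Lemma rnorm_equiv_near i p : dom i p ->
  exists2 K : R, 0 < K & \forall x \near p, forall u : 'rV[R]_n,
    `|u| <= K * rnorm g x (u *m coord_change i (frame x) x) /\
    rnorm g x (u *m coord_change i (frame x) x) <= K * `|u|.
Proof.
move=> ip.
pose P x := coord_change i (frame x) x.
pose H x := P x *m gram g x *m (P x)^T.
have HE x u : rnorm g x (u *m P x) = qnorm (H x) u.
  by rewrite /rnorm /qnorm /bform /H trmx_mul !mulmxA.
have Hp : inner_product (H p).
  split; first by rewrite /H !trmx_mul trmxK gram_sym mulmxA.
  move=> v v0; have := gram_pos g p (v := v *m P p).
  rewrite /bform /H trmx_mul !mulmxA; apply.
  apply: contra v0 => /eqP vP; apply/eqP.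
  rewrite -[v]mulmx1 -(coord_changeK ip (dom_chart_at A p)) mulmxA.
  by rewrite -/(P p) vP mul0mx.
have [K [e [K0 e0 HK]]] := qnorm_equiv_near Hp.
exists K => //.
have Hc : \forall x \near p, `|H x - H p| <= e.
  have Hy := gram_Cr g i (k := 0) hr.
  have yi : chart i p \in chart i @` dom i by rewrite inE; exists p.
  have := continuous_comp (chart_cts ip) (Hy _ yi).
  set h := (X in X \o _).
  have hE x : dom i x -> (h \o chart i) x = H x.
    by move=> ix; rewrite /h /comp /= (chartKin ix).
  clearbody h H.
  move/(@cvgrPdist_le _ _ _ _ (nbhs_filter p))/(_ _ e0).
  rewrite (hE p ip); apply: filterS2 (dom_nbhs ip) => x ix.
  by rewrite (hE x ix) distrC.
by apply: filterS Hc => x /HK Hx u; rewrite HE.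
Unshelve. all: by end_near. Qed.

Variables Es Eu : M -> 'M[R]_n.
Hypothesis Es_cont : continuous_subbundle A Es.
Hypothesis Eu_cont : continuous_subbundle A Eu.
Hypothesis EsEu : splits_tangent Es Eu.

Definition stable_part x : 'M[R]_n := proj_mx (Es x) (Eu x).
Definition unstable_part x : 'M[R]_n := proj_mx (Eu x) (Es x).

(** Comparing with this norm, rather than with [rnorm] and the projections
    separately, gives both bounds that the cone argument uses: the chart norm is
    controlled by the two components, and the components by the chart norm. *)
Definition split_norm x (w : 'rV[R]_n) : R :=
  rnorm g x (w *m stable_part x) + rnorm g x (w *m unstable_part x).

Lemma stable_unstable_decomposition x (w : 'rV[R]_n) :
  w *m stable_part x + w *m unstable_part x = w.
Proof.
have [E I] := EsEu x; rewrite /stable_part /unstable_part add_proj_mx//.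
by rewrite E submx1.
Qed.

Lemma frames_near p : exists d1 d2 (B1 : M -> 'M[R]_(d1, n))
    (B2 : M -> 'M[R]_(d2, n)),
  [/\ row_free (col_mx (B1 p) (B2 p)), {for p, continuous B1},
      {for p, continuous B2} &
   \forall x \near p,
     (Es x *m coord_change (frame x) (frame p) x :=: B1 x)%MS /\
     (Eu x *m coord_change (frame x) (frame p) x :=: B2 x)%MS].
Proof.
have [d1 [B1 H1]] := Es_cont p; have [d2 [B2 H2]] := Eu_cont p.
exists d1, d2, B1, B2.
have [_ B1c B1f E1] := nbhs_singleton H1.
have [_ B2c B2f E2] := nbhs_singleton H2.
split => //; last first.
  by apply: filterS2 H1 H2 => x [_ _ _ h1] [_ _ _ h2].
move: E1 E2; rewrite coord_change_id ?mulmx1; last exact: dom_chart_at.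
move=> E1 E2; have [_ I] := EsEu p.
rewrite /row_free -addsmxE mxrank_disjoint_sum.
  by move/eqP: B1f => ->; move/eqP: B2f => ->.
apply/eqP; rewrite -submx0 -I sub_capmx.
by rewrite (submx_trans (capmxSl _ _)) ?E1// (submx_trans (capmxSr _ _)) ?E2.
Qed.

(** In the coordinates of the chart preferred at [p] the two subbundles have
    continuous frames; the components of [u] along these frames are bounded by
    [frame_components_bound], and their norms by [rnorm_equiv_near]. *)
Lemma split_norm_equiv_frame p :
  exists2 K : R, 0 < K & \forall x \near p, forall u : 'rV[R]_n,
    `|u| <= K * split_norm x (u *m coord_change (frame p) (frame x) x) /\
    split_norm x (u *m coord_change (frame p) (frame x) x) <= K * `|u|.
Proof.
have [d1 [d2 [B1 [B2 [Bf B1c B2c BE]]]]] := frames_near p.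
have [K1 [e [K10 e0 HB]]] := frame_components_bound Bf.
have pp := dom_chart_at A p.
have [K2 K20 HK2] := rnorm_equiv_near pp.
have K120 : 0 < K2 * (K1 + K1) by rewrite mulr_gt0// addr_gt0.
exists (K2 + K2 * (K1 + K1)); first by rewrite addr_gt0.
have B1n : \forall x \near p, `|B1 x - B1 p| <= e.
  move/(@cvgrPdist_le _ _ _ _ (nbhs_filter p))/(_ _ e0): B1c.
  by apply: filterS => x; rewrite distrC.
have B2n : \forall x \near p, `|B2 x - B2 p| <= e.
  move/(@cvgrPdist_le _ _ _ _ (nbhs_filter p))/(_ _ e0): B2c.
  by apply: filterS => x; rewrite distrC.
near=> x => u.
have px : dom (frame p) x by near: x; exact: dom_nbhs.
have xx := dom_chart_at A x.
have [E1 E2] : (Es x *m coord_change (frame x) (frame p) x :=: B1 x)%MS /\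
     (Eu x *m coord_change (frame x) (frame p) x :=: B2 x)%MS by near: x.
have Hx (v : 'rV[R]_n) :
    `|v| <= K2 * rnorm g x (v *m coord_change (frame p) (frame x) x) /\
    rnorm g x (v *m coord_change (frame p) (frame x) x) <= K2 * `|v|.
  by move: v; near: x.
set P := coord_change (frame p) (frame x) x in Hx *.
set Q := coord_change (frame x) (frame p) x in E1 E2.
have PQ : P *m Q = 1%:M by exact: coord_changeK.
have QP : Q *m P = 1%:M by exact: coord_changeK.
set s := u *m P *m stable_part x; set t := u *m P *m unstable_part x.
have uE : u = s *m Q + t *m Q.
  by rewrite -mulmxDl stable_unstable_decomposition -mulmxA PQ mulmx1.
have [a Ea] : exists a, s *m Q = a *m B1 x.
  by apply/submxP; rewrite -E1 submxMr// proj_mx_sub.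
have [b Eb] : exists b, t *m Q = b *m B2 x.
  by apply/submxP; rewrite -E2 submxMr// proj_mx_sub.
have [ua ub] : `|s *m Q| <= K1 * `|u| /\ `|t *m Q| <= K1 * `|u|.
  rewrite [u]uE Ea Eb; apply: HB; first by near: x.
  by near: x.
rewrite /split_norm -/s -/t; clearbody s t P Q.
have [ls us] := Hx (s *m Q); have [lt ut] := Hx (t *m Q).
rewrite -mulmxA QP mulmx1 in ls us; rewrite -mulmxA QP mulmx1 in lt ut.
have s0 := rnorm_ge0 x s; have t0 := rnorm_ge0 x t.
split.
  apply: (@le_trans _ _ (K2 * (rnorm g x s + rnorm g x t))).
    rewrite [in leLHS]uE (le_trans (ler_normD _ _))// mulrDr.
    exact: lerD.
  by rewrite ler_wpM2r ?addr_ge0// lerDl ltW.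
apply: (@le_trans _ _ (K2 * (K1 + K1) * `|u|)).
  rewrite -mulrA mulrDl mulrDr lerD//.
    by rewrite (le_trans us)// ler_wpM2l// ltW.
  by rewrite (le_trans ut)// ler_wpM2l// ltW.
by rewrite ler_wpM2r// lerDr ltW.
Unshelve. all: by end_near. Qed.

Lemma split_norm_equiv_near i p : dom i p ->
  exists2 K : R, 0 < K & \forall x \near p, forall u : 'rV[R]_n,
    `|u| <= K * split_norm x (u *m coord_change i (frame x) x) /\
    split_norm x (u *m coord_change i (frame x) x) <= K * `|u|.
Proof.
move=> ip; have pp := dom_chart_at A p.
have [K1 K10 H1] := split_norm_equiv_frame p.
have [K2 K20 H2] := coord_change_bound ip pp.
have [K3 K30 H3] := coord_change_bound pp ip.
exists (K1 * (K2 + K3)); first by rewrite mulr_gt0// addr_gt0.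
near=> x => u.
have px : dom (frame p) x by near: x; exact: dom_nbhs.
have ix : dom i x by near: x; exact: dom_nbhs.
have xx := dom_chart_at A x.
have h1 (v : 'rV[R]_n) :
    `|v| <= K1 * split_norm x (v *m coord_change (frame p) (frame x) x) /\
    split_norm x (v *m coord_change (frame p) (frame x) x) <= K1 * `|v|.
  by move: v; near: x.
have h2 (v : 'rV[R]_n) : `|v *m coord_change i (frame p) x| <= K2 * `|v|.
  by move: v; near: x.
have h3 (v : 'rV[R]_n) : `|v *m coord_change (frame p) i x| <= K3 * `|v|.
  by move: v; near: x.
rewrite -(coord_change_trans ix px xx) mulmxA.
set T := coord_change i (frame p) x in h2 *.
set S := coord_change (frame p) i x in h3.
have TS : T *m S = 1%:M by exact: coord_changeK.
have [lo up] := h1 (u *m T).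
set q := split_norm _ _ in lo up *.
have q0 : 0 <= q by rewrite addr_ge0 ?rnorm_ge0.
clearbody q T S; split.
  rewrite -[u in leLHS]mulmx1 -TS mulmxA (le_trans (h3 _))//.
  apply: (@le_trans _ _ (K3 * (K1 * q))); first by rewrite ler_wpM2l// ltW.
  rewrite mulrA ler_wpM2r// mulrC ler_wpM2l ?(ltW K10)//.
  by rewrite lerDr ltW.
apply: le_trans up _; rewrite -mulrA; apply: ler_wpM2l (ltW K10) _ _ _.
by apply: le_trans (h2 u) _; rewrite ler_wpM2r// lerDl ltW.
Unshelve. all: by end_near. Qed.

End LocalBounds.

(** * Locally finite choice of charts *)

Section ChartSelection.
Context {R : realType} {r : regularity} {n : nat} {M : metricType R}.
Variable A : atlas r n M.

(** [c] takes near each point [p] finitely many values, all of them charts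
    around [p]. This is expressed by its effect: a property that holds near [p]
    for each fixed chart around [p] holds near [p] for the chart selected by
    [c]. The parameter [h] allows the selection at a point that depends on other
    data, such as the image of the first point of a pair. *)
Definition locally_finite_selection (c : M -> idx A) : Prop :=
  forall (T : Type) (G : set_system T) (h : T -> M) (p : M)
    (Phi : idx A -> T -> Prop), Filter G -> h @ G --> p ->
    (forall i, dom i p -> \forall t \near G, Phi i t) ->
    \forall t \near G, Phi (c (h t)) t.

Lemma rational_point_near (z : 'rV[R]_n) (e : R) : 0 < e ->
  exists q : 'rV[rat]_n, ball z e (map_mx ratr q).
Proof.
move=> e0.
have H k : exists q : rat, `|z 0 k - ratr q| < e / 2.
  have [q] : exists q, ratr q \in `](z 0 k - e / 2), (z 0 k + e / 2)[.
    by apply: rat_in_itvoo; rewrite ltrD2l gt0_cp// divr_gt0.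
  rewrite in_itv/= => /andP[h1 h2]; exists q.
  by rewrite ltr_norml; apply/andP; split; lra.
have [q qP] := choice H.
exists (\row_k q k); rewrite -ball_normE /=.
apply: (@le_lt_trans _ _ (e / 2)); last by rewrite ltr_pdivrMr// ltr_pMr// ltr1n.
apply: mx_norm_le => [|i k]; first by rewrite divr_ge0// ltW.
by rewrite (ord1 i) !mxE ltW.
Qed.

(** Cover [M] by the quarter balls of a sequence [pt] of points whose full balls
    lie in the domain of a chart, and select at [x] the chart of the first
    quarter ball containing [x]. Near [p] this index is at most that of a quarter
    ball around [p]; and a quarter ball that meets every neighbourhood of [p]
    has a full ball, hence a chart, containing [p]. *)
Lemma exists_locally_finite_selection : connected [set: M] ->
  exists c, locally_finite_selection c.
Proof.
move=> Mc.
have [[x0 _]|M0] := pselect (exists x : M, True); last first.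
  exists (chart_at A).
  by move=> T G h p; exfalso; apply: M0; exists p.
have [e [e0 eL eQ]] : exists e : M -> R, [/\ forall x, 0 < e x,
    forall x y, e x <= e y + mdist x y &
    forall x, exists i : idx A, ball x (e x) `<=` dom i].
  apply: (@lipschitz_radius _ _ (fun B => exists i : idx A, B `<=` dom i)).
    by move=> B B' BB' [i Hi]; exists i; apply: subset_trans Hi.
  move=> p; exists (dom (chart_at A p)); last by exists (chart_at A p).
  by apply: dom_nbhs; exact: dom_chart_at.
have [ci ciP] := choice eQ.
pose q x k := if unpickle k is Some v
  then chart_inv (ci x) (map_mx ratr (v : 'rV[rat]_n)) else x.
have qd x z : ball x (e x) z -> forall s, 0 < s -> exists k, ball z s (q x k).
  move=> /ciP iz s s0.
  have : nbhs (chart (ci x) z) (chart_inv (ci x) @^-1` ball z s).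
    by apply: chart_inv_cts => //; rewrite chartKin//; exact: nbhsx_ballx.
  move=> /nbhs_ballP[d /= d0 dB].
  have [v /dB vB] := rational_point_near (chart (ci x) z) d0.
  by exists (pickle v); rewrite /q pickleK.
have [pt ptP] := countable_ball_cover x0 Mc e0 eL qd.
have ptB x : exists j, `[< ball (pt j) (e (pt j) / 4) x >].
  by have [j /asboolP] := ptP x; exists j.
exists (fun x => ci (pt (ex_minn (ptB x)))).
move=> T G h p Phi FG hG HPhi.
have [j0 j0P] := ptP p.
have ball_near j s : ball (pt j) s p -> \forall t \near G, ball (pt j) s (h t).
  rewrite ballEmdist/= => js.
  have d0 : 0 < s - mdist (pt j) p by rewrite subr_gt0.
  have hp : G (h @^-1` ball p _) := hG _ (nbhsx_ballx p _ d0).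
  apply: filterS hp => t /=.
  by rewrite !ballEmdist/=; have := metric_triangle (pt j) p (h t); lra.
have Hj (j : 'I_j0.+1) : \forall t \near G,
    ball (pt j) (e (pt j) / 4) (h t) -> Phi (ci (pt j)) t.
  have [/ciP/HPhi|np] := pselect (ball (pt j) (e (pt j)) p).
    exact: filterS.
  have d0 : 0 < e (pt j) / 2 by rewrite divr_gt0.
  have hp : G (h @^-1` ball p _) := hG _ (nbhsx_ballx p _ d0).
  apply: filterS hp => t /=.
  rewrite !ballEmdist/= (metric_sym p) => h1 h2; exfalso; apply: np.
  rewrite ballEmdist/=; have := metric_triangle (pt j) (h t) p.
  by have := e0 (pt j); lra.
have Hall := @filter_forall T _ _ G FG Hj.
apply: filterS2 Hall (ball_near _ _ j0P) => t Ht Bt.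
case: ex_minnP => j /asboolP jB /(_ j0) jmin.
have jj0 : (j < j0.+1)%N by rewrite ltnS; apply: jmin; apply/asboolP.
exact: (Ht (Ordinal jj0)).
Qed.

End ChartSelection.

(** * The cone argument *)

(** By induction [S k <= U k] and [U] at least doubles: the cone condition
    gives [S k.+1 <= 3/4 * U k] and [U k.+1 >= 7/2 * U k]. *)
Lemma cone_growth (R : realType) (S U : nat -> R) :
  (forall k, 0 <= S k) -> (forall k, S k + U k <= 1) ->
  (forall k, S k.+1 <= S k / 4 + (S k + U k) / 4) ->
  (forall k, 4 * U k <= U k.+1 + (S k + U k) / 4) ->
  0 <= U 0 -> S 0 <= U 0 -> U 0 = 0.
Proof.
move=> S0 SU1 SS UU U00 SU0.
have H k : S k <= U k /\ 2 ^+ k * U 0 <= U k.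
  elim: k => [|k [IH1 IH2]]; first by rewrite expr0 mul1r.
  have := S0 k; have := SS k; have := UU k; rewrite exprS -mulrA; split; lra.
apply/eqP; rewrite eq_le U00 andbT leNgt; apply/negP => Up.
have [k kP] : exists k : nat, (U 0)^-1 < k%:R.
  by exists (Num.bound (U 0)^-1); apply: archi_boundP; rewrite invr_ge0.
have : 1 < 2 ^+ k * U 0.
  rewrite -ltr_pdivrMr// mul1r (lt_trans kP)//.
  by rewrite -natrX ltr_nat ltn_expl.
have [_ h1] := H k; have := SU1 k; have := S0 k; lra.
Qed.

Lemma near_preimage (T U : topologicalType) (F : T -> U) (p : T) (P : set U) :
  {for p, continuous F} -> (\forall x \near F p, P x) ->
  \forall x \near p, P (F x).
Proof. by move=> Fc; exact: Fc. Qed.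

Section ConeField.
Context {R : realType} {r : regularity} {n : nat} {M : metricType R}.
Variables (A : atlas r n M) (hr : reg_le 1 r) (g : riemannian_metric A).
Variable c : M -> idx A.
Hypothesis c_fin : locally_finite_selection c.

Definition displacement (i : idx A) (x y : M) : 'rV[R]_n :=
  (chart i y - chart i x) *m coord_change i (chart_at A x) x.

Definition hyperbolic_step (F : M -> M) (DF E1 E2 : M -> 'M[R]_n) : Prop :=
  forall x (w : 'rV[R]_n),
    ((w <= E1 x)%MS -> (w *m DF x <= E1 (F x))%MS /\
      4 * rnorm g (F x) (w *m DF x) <= rnorm g x w) /\
    ((w <= E2 x)%MS -> (w *m DF x <= E2 (F x))%MS /\
      4 * rnorm g x w <= rnorm g (F x) (w *m DF x)).

Lemma strict_differential_in_charts F DF i j x : 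
  strict_differential (chart_at A x) (chart_at A (F x)) F x DF ->
  dom i x -> dom j (F x) ->
  strict_differential i j F x (coord_change i (chart_at A x) x *m DF *m
    coord_change (chart_at A (F x)) j (F x)).
Proof.
move=> FD ix jx.
have D1 := strict_differential_coord_change hr ix (dom_chart_at A x).
have D2 := strict_differential_coord_change hr (dom_chart_at A (F x)) jx.
exact: (strict_differential_comp (strict_differential_comp D1 FD) D2).
Qed.

Variables (F : M -> M) (DF E1 E2 : M -> 'M[R]_n).
Hypothesis FDF : forall x,
  strict_differential (chart_at A x) (chart_at A (F x)) F x (DF x).
Hypothesis E1_cont : continuous_subbundle A E1.
Hypothesis E2_cont : continuous_subbundle A E2.
Hypothesis E12 : splits_tangent E1 E2.
Hypothesis F_hyp : hyperbolic_step F DF E1 E2.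

Let S i x y := rnorm g x (displacement i x y *m stable_part E1 E2 x).
Let U i x y := rnorm g x (displacement i x y *m unstable_part E1 E2 x).

Lemma split_components x (w : 'rV[R]_n) :
  w *m DF x *m stable_part E1 E2 (F x) = w *m stable_part E1 E2 x *m DF x /\
  w *m DF x *m unstable_part E1 E2 (F x) = w *m unstable_part E1 E2 x *m DF x.
Proof.
set s := w *m stable_part E1 E2 x; set t := w *m unstable_part E1 E2 x.
have wE : w = s + t by rewrite stable_unstable_decomposition.
have sE : (s *m DF x <= E1 (F x))%MS.
  by have [H _] := F_hyp x s; have [] := H (proj_mx_sub _ _ _).
have tE : (t *m DF x <= E2 (F x))%MS.
  by have [_ H] := F_hyp x t; have [] := H (proj_mx_sub _ _ _).
have [_ I] := E12 (F x).
have I' : (E2 (F x) :&: E1 (F x))%MS = 0 by rewrite capmxC.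
rewrite [w in w *m DF x]wE; clearbody s t.
by rewrite mulmxDl !mulmxDl /stable_part /unstable_part (proj_mx_id I sE)
  (proj_mx_0 I tE) (proj_mx_id I' tE) (proj_mx_0 I' sE) addr0 add0r.
Qed.

(** One step of the cone argument at the level of tangent vectors; [e] is the
    error of the linear approximation. *)
Lemma perturbed_step x (v v' e : 'rV[R]_n) : v' = e + v *m DF x ->
  split_norm g E1 E2 (F x) e <= split_norm g E1 E2 x v / 4 ->
  rnorm g (F x) (v' *m stable_part E1 E2 (F x)) <=
    rnorm g x (v *m stable_part E1 E2 x) / 4 + split_norm g E1 E2 x v / 4 /\
  4 * rnorm g x (v *m unstable_part E1 E2 x) <=
    rnorm g (F x) (v' *m unstable_part E1 E2 (F x)) + split_norm g E1 E2 x v / 4.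
Proof.
move=> v'E errE.
have [c1 c2] := split_components x v.
have [HE1 _] := F_hyp x (v *m stable_part E1 E2 x).
have [_ {}HE1] := HE1 (proj_mx_sub _ _ _).
have [_ HE2] := F_hyp x (v *m unstable_part E1 E2 x).
have [_ {}HE2] := HE2 (proj_mx_sub _ _ _).
rewrite -c1 in HE1; rewrite -c2 in HE2.
have es0 := rnorm_ge0 g (F x) (e *m stable_part E1 E2 (F x)).
have eu0 := rnorm_ge0 g (F x) (e *m unstable_part E1 E2 (F x)).
rewrite {1}/split_norm in errE.
split.
  rewrite v'E mulmxDl; apply: le_trans (rnormD _ _ _ _) _; lra.
apply: le_trans HE2 _.
have -> : v *m DF x *m unstable_part E1 E2 (F x) =
    v' *m unstable_part E1 E2 (F x) - e *m unstable_part E1 E2 (F x).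
  by rewrite v'E mulmxDl addrAC subrr add0r.
by apply: le_trans (rnormD _ _ _ _) _; rewrite rnormN; lra.
Qed.

Let cone_step i j (z : M * M) : Prop :=
    [/\ S j (F z.1) (F z.2) <= S i z.1 z.2 / 4 + (S i z.1 z.2 + U i z.1 z.2) / 4,
        4 * U i z.1 z.2 <= U j (F z.1) (F z.2) + (S i z.1 z.2 + U i z.1 z.2) / 4,
        S i z.1 z.2 + U i z.1 z.2 <= 1 &
        S i z.1 z.2 + U i z.1 z.2 = 0 -> z.1 = z.2].

(** The error [e] of the linear approximation at [x] is at most
    [2 * eta * `|u|]: one [eta] comes from strict differentiability at [p], the
    other from the variation of the differential between [p] and [x]. The last
    conclusion holds because a vector without components is zero, and charts are
    injective. *)
Lemma cone_estimates_in_charts i j p : dom i p -> dom j (F p) ->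
  \forall z \near (p, p), cone_step i j z.
Proof.
move=> ip jp.
have [Ki Ki0 HKi] := split_norm_equiv_near hr g E1_cont E2_cont E12 ip.
have [Kj Kj0 HKj] := split_norm_equiv_near hr g E1_cont E2_cont E12 jp.
have [Lp FLp] : exists L, strict_differential i j F p L.
  by eexists; exact: strict_differential_in_charts (FDF p) ip jp.
have [_ _ Fc _] := FLp.
(* With this value the error, of norm at most [Kj * (2 * eta * Ki)] times that
   of the displacement, takes a quarter of it. *)
pose eta := (8 * Ki * Kj)^-1.
have eta0 : 0 < eta by rewrite invr_gt0 !mulr_gt0.
have near_L := strict_differential_near FLp eta0.
have [_ _ _ /(_ _ eta0)[W pW HW]] := FLp.
have Ki'0 : 0 < (2 * Ki)^-1 by rewrite invr_gt0 mulr_gt0.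
pose V := [set x | [/\ dom i x, dom j (F x), W x,
  `|chart i p - chart i x| <= (2 * Ki)^-1 &
  [/\ forall L', strict_differential i j F x L' ->
    forall u : 'rV[R]_n, `|u *m (L' - Lp)| <= eta * `|u|,
  forall u : 'rV[R]_n,
    `|u| <= Ki * split_norm g E1 E2 x (u *m coord_change i (chart_at A x) x) /\
    split_norm g E1 E2 x (u *m coord_change i (chart_at A x) x) <= Ki * `|u| &
  forall u : 'rV[R]_n,
    `|u| <= Kj * split_norm g E1 E2 (F x)
              (u *m coord_change j (chart_at A (F x)) (F x)) /\
    split_norm g E1 E2 (F x) (u *m coord_change j (chart_at A (F x)) (F x))
      <= Kj * `|u|]]].
have pV : nbhs p V.
  have n1 := dom_nbhs ip.
  have n2 : nbhs p (F @^-1` dom j) by apply: Fc; exact: dom_nbhs.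
  have n3 : \forall x \near p, `|chart i p - chart i x| <= (2 * Ki)^-1.
    exact: (@cvgrPdist_le _ _ _ _ (nbhs_filter p) _ _).1 (chart_cts ip) _ Ki'0.
  have n4 := near_preimage Fc HKj.
  apply: filterS2 (filterI n1 (filterI n2 (filterI pW n3)))
    (filterI near_L (filterI HKi n4)) => x [h1 [h2 [h3 h4]]] [h5 [h6 h7]].
  split; [exact: h1|exact: h2|exact: h3|exact: h4|].
  split; [exact: h5|exact: h6|exact: h7].
exists (V, V) => // -[x y] [/= Vx Vy].
have [ix jx Wx cx [Lx Nx NFx]] := Vx.
have [iy jy Wy cy _] := Vy.
have := HW _ _ Wx Wy.
have := Lx _ (strict_differential_in_charts (FDF x) ix jx).
move=> {}Lx {}HW.
(* Displacements and jacobians become variables, so that conversion cannot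
   unfold them in the computation below. *)
have [u uE] : {u : 'rV[R]_n | u = chart i y - chart i x}
  by exact: (exist _ _ erefl).
have [u' u'E] : {v : 'rV[R]_n | v = chart j (F y) - chart j (F x)}
  by exact: (exist _ _ erefl).
rewrite -uE -u'E in HW.
have [P PE] : {P : 'M[R]_n | P = coord_change i (chart_at A x) x}
  by exact: (exist _ _ erefl).
rewrite -PE in Lx Nx.
have [P' P'E] : {P : 'M[R]_n | P = coord_change j (chart_at A (F x)) (F x)}.
  by exact: (exist _ _ erefl).
rewrite -P'E in NFx.
have [Q' Q'E] : {P : 'M[R]_n | P = coord_change (chart_at A (F x)) j (F x)}.
  by exact: (exist _ _ erefl).
rewrite -Q'E in Lx.
have QP' : Q' *m P' = 1%:M.
  by rewrite Q'E P'E coord_changeK//; exact: dom_chart_at.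
have dE : displacement i x y = u *m P by rewrite uE PE; exact: erefl.
have dE'0 : displacement j (F x) (F y) = u' *m P' by rewrite u'E P'E; exact: erefl.
have L'E : P *m DF x *m Q' *m P' = P *m DF x by rewrite -mulmxA QP' mulmx1.
have {}Lx := Lx u.
set L := P *m DF x *m Q' in Lx L'E *; clearbody L.
pose e := u' - u *m L.
have eu : `|e| <= 2 * eta * `|u|.
  have -> : e = (u' - u *m Lp) - u *m (L - Lp).
    by rewrite mulmxBr opprB addrA subrK.
  rewrite (le_trans (ler_normB _ _))//.
  by have := HW; lra.
have [lo up] := Nx u.
have dE' : displacement j (F x) (F y) = e *m P' + (u *m P) *m DF x.
  by rewrite dE'0 /e -mulmxA -L'E mulmxA -mulmxDl subrK.
clearbody e.
have NSU : split_norm g E1 E2 x (u *m P) = S i x y + U i x y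
  by rewrite /S /U dE.
have errN : split_norm g E1 E2 (F x) (e *m P') <=
    split_norm g E1 E2 x (u *m P) / 4.
  rewrite NSU.
  have [_ up'] := NFx e; apply: le_trans up' _.
  apply: (@le_trans _ _ (Kj * (2 * eta * (Ki * (S i x y + U i x y))))).
    apply: ler_wpM2l (ltW Kj0) _ _ _; apply: le_trans eu _.
    by rewrite -NSU ler_pM2l// mulr_gt0.
  rewrite /eta !invfM.
  have -> : Kj * (2 * (8^-1 * Ki^-1 * Kj^-1) * (Ki * (S i x y + U i x y))) =
    (Kj / Kj) * (Ki / Ki) * ((S i x y + U i x y) / 4) by lra.
  by rewrite !divff ?gt_eqF// !mul1r.
have [st1 st2] := perturbed_step dE' errN.
rewrite /split_norm -dE in st1 st2.
split; [exact: st1|exact: st2| |].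
- rewrite -NSU (le_trans up)// mulrC -ler_pdivlMr// mul1r.
  have -> : Ki^-1 = (2 * Ki)^-1 + (2 * Ki)^-1 by rewrite invfM; lra.
  have -> : u = (chart i p - chart i x) - (chart i p - chart i y).
    by rewrite opprB addrC subrKA uE.
  by rewrite (le_trans (ler_normB _ _))// lerD.
- rewrite -NSU => N0; move: lo; rewrite N0 mulr0 normr_le0 uE subr_eq0 => /eqP E.
  exact: chart_inj ix iy (esym E).
Qed.

Lemma one_sided_expansivity : exists e : M -> R,
  [/\ continuous e, forall x, 0 < e x &
   forall x y, (forall k, mdist (iter k F x) (iter k F y) < e (iter k F x)) ->
     S (c x) x y <= U (c x) x y -> x = y].
Proof.
have [e [e0 eL eQ]] : exists e : M -> R, [/\ forall x, 0 < e x,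
    forall x y, e x <= e y + mdist x y &
    forall x, forall y z, ball x (e x) y -> ball x (e x) z ->
      cone_step (c y) (c (F y)) (y, z)].
  apply: (@lipschitz_radius _ _ (fun B => forall y z, B y -> B z ->
      cone_step (c y) (c (F y)) (y, z))).
    by move=> B B' BB' H y z By Bz; apply: H; exact: BB'.
  move=> p; have [_ _ Fc _] := FDF p.
  have : \forall z \near (p, p), cone_step (c z.1) (c (F z.1)) z.
    (* The chart at [z.1] is selected first, then the chart at its image. *)
    refine (@c_fin (M * M)%type (nbhs (p, p)) fst p
      (fun i z => cone_step i (c (F z.1)) z) _ _ _); first exact: cvg_fst.
    move=> i ip.
    refine (@c_fin (M * M)%type (nbhs (p, p)) (F \o fst) (F p) (cone_step i) _ _ _).
      exact: (@cvg_comp _ _ _ fst F (nbhs (p, p)) (nbhs p) (nbhs (F p)) cvg_fst Fc).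
    by move=> j jp; exact: cone_estimates_in_charts.
  move=> [[W1 W2] /= [pW1 pW2] W12].
  exists (W1 `&` W2); first exact: filterI.
  by move=> y z [Wy _] [_ Wz]; apply: (W12 (y, z)).
exists e; split => //; first exact: lipschitz_continuous.
move=> x y xy SU.
have H k : cone_step (c (iter k F x)) (c (iter k.+1 F x)) (iter k F x, iter k F y).
  apply: eQ; first exact: ballxx.
  by rewrite ballEmdist/=; exact: xy.
have [_ _ _ H0] := H 0.
apply: H0 => /=.
have S0 : 0 <= S (c x) x y by exact: rnorm_ge0.
have U0 : 0 <= U (c x) x y by exact: rnorm_ge0.
have : U (c x) x y = 0.
  apply: (@cone_growth R
    (fun k => S (c (iter k F x)) (iter k F x) (iter k F y))
    (fun k => U (c (iter k F x)) (iter k F x) (iter k F y))) => //=.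
  - by move=> k; exact: rnorm_ge0.
  - by move=> k; have [] := H k.
  - by move=> k; have [] := H k.
  - by move=> k; have [] := H k.
lra.
Qed.

End ConeField.

(** * Iterates, inverses and the theorem *)

Section TangentMaps.
Context {R : realType} {r : regularity} {n : nat} {M : metricType R}.
Variable A : atlas r n M.
Implicit Types (f F : M -> M).

Local Notation frame x := (chart_at A x).

Lemma tangent_mapE F x L :
  strict_differential (frame x) (frame (F x)) F x L -> tangent_map A F x = L.
Proof. exact: strict_differential_jacobian. Qed.

Lemma strict_differential_tangent_map f x : C1_map A f ->
  strict_differential (frame x) (frame (f x)) f x (tangent_map A f x).
Proof. by move=> f1; apply: C1_strict_differential => //; exact: dom_chart_at. Qed.

Lemma strict_differential_iter f m x : C1_map A f ->
  strict_differential (frame x) (frame (iter m f x)) (iter m f) x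
    (tangent_map A (iter m f) x).
Proof.
move=> f1; suff [L FL] : exists L,
    strict_differential (frame x) (frame (iter m f x)) (iter m f) x L.
  by rewrite (tangent_mapE FL).
elim: m => [|m [L FL]].
  by exists 1%:M; apply: strict_differential_id; exact: dom_chart_at.
eexists; exact: strict_differential_comp FL (strict_differential_tangent_map _ f1).
Qed.

Lemma tangent_map_iterS f m x : C1_map A f ->
  tangent_map A (iter m.+1 f) x =
    tangent_map A (iter m f) x *m tangent_map A f (iter m f x).
Proof.
move=> f1; apply: tangent_mapE.
exact: strict_differential_comp (strict_differential_iter m x f1)
  (strict_differential_tangent_map _ f1).
Qed.

Lemma invariant_subbundle_iter f E m : C1_map A f ->
  invariant_subbundle A f E -> invariant_subbundle A (iter m f) E.
Proof.
move=> f1 Ef x; elim: m => [|m IH].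
  rewrite (_ : tangent_map A (iter 0 f) x = 1%:M) ?mulmx1//.
  by apply: tangent_mapE; apply: strict_differential_id; exact: dom_chart_at.
rewrite tangent_map_iterS// mulmxA.
exact: eqmx_trans (eqmxMr _ IH) (Ef _).
Qed.

Lemma strict_differential_cancel F F' x L L' : cancel F F' ->
  strict_differential (frame x) (frame (F x)) F x L ->
  strict_differential (frame (F x)) (frame (F' (F x))) F' (F x) L' ->
  L *m L' = 1%:M.
Proof.
move=> FK FL FL'; have := strict_differential_comp FL FL'.
rewrite FK (_ : F' \o F = idfun); last by apply/funext => y /=; rewrite FK.
move/strict_differential_unique; apply.
by apply: strict_differential_id; exact: dom_chart_at.
Qed.

Section Inverse.
Variables (F F' : M -> M) (DF DF' : M -> 'M[R]_n).
Hypothesis FK : cancel F F'.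
Hypothesis F'K : cancel F' F.
Hypothesis FD : forall x,
  strict_differential (frame x) (frame (F x)) F x (DF x).
Hypothesis F'D : forall x,
  strict_differential (frame x) (frame (F' x)) F' x (DF' x).

Lemma invariant_inverse (E : M -> 'M[R]_n) :
  (forall x, (E x *m DF x :=: E (F x))%MS) ->
  forall x, (E x *m DF' x :=: E (F' x))%MS.
Proof.
move=> EF x; rewrite -{1 2}(F'K x); set y := F' x.
apply: eqmx_trans (eqmxMr _ (eqmx_sym (EF y))) _.
by rewrite -mulmxA (strict_differential_cancel FK (FD y) (F'D _)) mulmx1.
Qed.

(** The expansion of [E2] by [F] is its contraction by the inverse, applied to
    the vector [w *m DF x]. *)
Lemma hyperbolic_step_of_contractions (g : riemannian_metric A)
    (E1 E2 : M -> 'M[R]_n) :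
  (forall x, (E1 x *m DF x :=: E1 (F x))%MS) ->
  (forall x, (E2 x *m DF x :=: E2 (F x))%MS) ->
  (forall x w, (w <= E1 x)%MS -> 4 * rnorm g (F x) (w *m DF x) <= rnorm g x w) ->
  (forall x w, (w <= E2 x)%MS ->
     4 * rnorm g (F' x) (w *m DF' x) <= rnorm g x w) ->
  hyperbolic_step g F DF E1 E2.
Proof.
move=> E1F E2F c1 c2 x w; split => wE.
  by split; [rewrite -E1F submxMr|exact: c1].
have wE2 : (w *m DF x <= E2 (F x))%MS by rewrite -E2F submxMr.
split => //; have := c2 _ _ wE2.
by rewrite FK -mulmxA (strict_differential_cancel FK (FD x) (F'D _)) mulmx1.
Qed.

End Inverse.

End TangentMaps.

Lemma exists_quarter_power (R : realType) (C l : R) : 0 < C -> 0 < l < 1 ->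
  exists N : nat, 4 * (C * l ^+ N) <= 1.
Proof.
move=> C0 /andP[l0 l1].
have : (fun k => l ^+ k) @ \oo --> (0 : R).
  by apply: cvg_expr; rewrite gtr0_norm.
have e0 : 0 < (4 * C)^-1 by rewrite invr_gt0 mulr_gt0.
move/cvgrPdist_le => /(_ _ e0) [N _ /(_ N (leqnn N))].
rewrite sub0r normrN ger0_norm ?exprn_ge0 ?(ltW l0)// => h; exists N.
by rewrite mulrA -ler_pdivlMl ?mulr_gt0// mulr1.
Qed.

Lemma iterz_mul (T : Type) (f f' : T -> T) N k x :
  iterz f f' (N * k)%N%:Z x = iter k (iter N f) x /\
  iterz f f' (- (N * k)%N%:Z) x = iter k (iter N f') x.
Proof.
have E h : iter (N * k) h x = iter k (iter N h) x.
  by elim: k => [|k IH]; rewrite ?muln0// mulnS iterD IH.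
split; first by rewrite -E.
by rewrite -E; case: (N * k)%N.
Qed.

Theorem theorem1 (R : realType) (r : regularity) (hr : reg_le 1 r)
    (n : nat) (hn : (0 < n)%N) (M : metricType R) (A : atlas r n M)
    (hM : connected [set: M]) (f finv : M -> M)
    (hf : C1_diffeo A f finv) (hA : anosov_realizable A f finv) :
  topologically_expansive f finv.
Proof.
have [fK finvK f1 finv1] := hf.
split; first by split => //; [exact: f1.1|exact: finv1.1].
have [g [Es [Eu [C [l [[Es_c Eu_c] EsEu [Es_f Eu_f] [C0 l01] hyp]]]]]] := hA.
have [N CN] := exists_quarter_power C0 l01.
have [c c_fin] := exists_locally_finite_selection A hM.
pose F := iter N f; pose F' := iter N finv.
have FK : cancel F F'.
  move=> x; rewrite /F /F'; elim: N {CN F F'} x => // k IH x.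
  by rewrite iterSr /= fK.
have F'K : cancel F' F.
  move=> x; rewrite /F /F'; elim: N {CN F F' FK} x => // k IH x.
  by rewrite iterSr /= finvK.
pose DF := tangent_map A F; pose DF' := tangent_map A F'.
have FD x : strict_differential (chart_at A x) (chart_at A (F x)) F x (DF x).
  exact: strict_differential_iter.
have F'D x :
    strict_differential (chart_at A x) (chart_at A (F' x)) F' x (DF' x).
  exact: strict_differential_iter.
have EsF : forall x, (Es x *m DF x :=: Es (F x))%MS.
  exact: invariant_subbundle_iter.
have EuF : forall x, (Eu x *m DF x :=: Eu (F x))%MS.
  exact: invariant_subbundle_iter.
have EsF' := invariant_inverse FK F'K FD F'D EsF.
have EuF' := invariant_inverse FK F'K FD F'D EuF.
have scale x (a : R) (w : 'rV[R]_n) : a <= C * l ^+ N * rnorm g x w ->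
    4 * a <= rnorm g x w.
  move=> h; apply: (@le_trans _ _ (4 * (C * l ^+ N) * rnorm g x w)).
    by rewrite -mulrA ler_pM2l.
  by rewrite ler_piMl// rnorm_ge0.
have cEs x w : (w <= Es x)%MS -> 4 * rnorm g (F x) (w *m DF x) <= rnorm g x w.
  by move=> wE; apply: scale; have [H _] := hyp x N w; exact: H.
have cEu x w : (w <= Eu x)%MS ->
    4 * rnorm g (F' x) (w *m DF' x) <= rnorm g x w.
  by move=> wE; apply: scale; have [_ H] := hyp x N w; exact: H.
have EuEs : splits_tangent Eu Es.
  by move=> x; have [E I] := EsEu x; rewrite addsmxC capmxC.
have hF := hyperbolic_step_of_contractions FK FD F'D EsF EuF cEs cEu.
have hF' := hyperbolic_step_of_contractions F'K F'D FD EuF' EsF' cEu cEs.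
have [e1 [e1c e10 He1]] :=
  one_sided_expansivity hr c_fin FD Es_c Eu_c EsEu hF.
have [e2 [e2c e20 He2]] :=
  one_sided_expansivity hr c_fin F'D Eu_c Es_c EuEs hF'.
exists (fun x => Num.min (e1 x) (e2 x)); split.
- by move=> x; apply: continuous_min; [exact: e1c|exact: e2c].
- by move=> x; rewrite lt_min e10 e20.
move=> x y xy.
set S := rnorm g x (displacement (c x) x y *m stable_part Es Eu x).
set U := rnorm g x (displacement (c x) x y *m unstable_part Es Eu x).
(* The stable part for the pair of subbundles (Eu, Es) is the unstable part for
   (Es, Eu); in the second case the iterates of F^-1 are the negative ones. *)
have [SU|/ltW US] := leP S U.
  apply: He1 => // k; have := xy (N * k)%N%:Z.
  have [Ex _] := iterz_mul f finv N k x; have [Ey _] := iterz_mul f finv N k y.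
  by rewrite Ex Ey lt_min => /andP[].
apply: He2 => // k; have := xy (- (N * k)%N%:Z).
have [_ Ex] := iterz_mul f finv N k x; have [_ Ey] := iterz_mul f finv N k y.
by rewrite Ex Ey lt_min => /andP[].
Qed.
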